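(* There are positive constants $c$ and $C$ such that for all positive integers $r$, \[ c\, r^{3/5} < f(r, \theta_{3,4}) < C\, r^{3/5}. \]
   Context: Let $r,k$ be positive integers. A graph $G$ is an $(r,k)$-graph if $V(G)$ can be partitioned into sets $V_1,\dots,V_r$ with $|V_i| \le k$ for all $i$ such that for every pair $i \neq j$ in $[r]$ there is an edge of $G$ with one endpoint in $V_i$ and the other in $V_j$. For a graph $H$, $f(r,H)$ is the minimum $k$ such that there exists an $H$-free $(r,k)$-graph. For integers $K,\ell \ge 2$, the theta graph $\theta_{K,\ell}$ is the graph consisting of $K$ internally vertex-disjoint paths, each of length $\ell$, all having the same two endpoints. *)

(* Defs.v *)
From mathcomp Require Import all_boot all_order all_algebra.
From mathcomp Require Import all_classical all_reals all_analysis.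
Set Implicit Arguments.
Unset Strict Implicit.
Unset Printing Implicit Defensive.

(* Finite graphs suffice: an (r,k)-graph has at most r * k vertices. *)
Record sgraph := SGraph {
  vertex :> finType;
  edge : rel vertex;
  edge_sym : symmetric edge;
  edge_irrefl : irreflexive edge }.

(* Subgraph containment, not necessarily induced. *)
Definition contains (G H : sgraph) : Prop :=
  exists2 phi : H -> G, injective phi &
    forall x y : H, edge x y -> edge (phi x) (phi y).

Definition free (H G : sgraph) : Prop := ~ contains G H.

Definition rk_graph (r k : nat) (G : sgraph) : Prop :=
  exists V : 'I_r -> {set G},
    [/\ \bigcup_(i < r) V i = [set: G]%SET,
        forall i j : 'I_r, i != j -> [disjoint V i & V j],
        forall i : 'I_r, #|V i| <= k
      & forall i j : 'I_r, i != j ->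
          exists x y : G, [/\ x \in V i, y \in V j & edge x y]].

Definition has_free_rk_graph (r : nat) (H : sgraph) (k : nat) : Prop :=
  0 < k /\ exists2 G : sgraph, rk_graph r k G & free H G.

Lemma ex_asbool_free_rk_graph (r : nat) (H : sgraph) :
  (exists k, has_free_rk_graph r H k) ->
  exists k, `[< has_free_rk_graph r H k >].
Proof. by move=> [k hk]; exists k; apply/asboolP. Qed.

(* The value is the junk 0 when there is no k at all; an actual minimum is
   positive. *)
Definition f (r : nat) (H : sgraph) : nat :=
  match pselect (exists k, has_free_rk_graph r H k) with
  | left ex => ex_minn (ex_asbool_free_rk_graph ex)
  | right _ => 0
  end.

Lemma f_minimum (r : nat) (H : sgraph) (k : nat) :
  has_free_rk_graph r H k ->
  has_free_rk_graph r H (f r H) /\ f r H <= k.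
Proof.
move=> hk; rewrite /f; case: pselect => [ex|]; last by case; exists k.
case: ex_minnP => m /asboolP hm min_m; split=> //.
by apply: min_m; apply/asboolP.
Qed.

(* [inl false] and [inl true] are the common endpoints; [inr (i, j)] is the
   internal vertex of the i-th path at distance j.+1 from [inl false] along
   that path. *)
Definition theta_vertex (K l : nat) : finType := (bool + 'I_K * 'I_l.-1)%type.

Definition theta_pos (K l : nat) (v : theta_vertex K l) : nat :=
  match v with
  | inl b => if b then l else 0
  | inr (_, j) => j.+1
  end.

Definition theta_same_path (K l : nat) (u v : theta_vertex K l) : bool :=
  match u, v with
  | inr (i, _), inr (i', _) => i == i'
  | _, _ => true
  end.

Definition theta_edge (K l : nat) : rel (theta_vertex K l) :=
  fun u v => theta_same_path u v &&
    (((theta_pos u).+1 == theta_pos v) || ((theta_pos v).+1 == theta_pos u)).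

Lemma theta_edge_sym (K l : nat) : symmetric (@theta_edge K l).
Proof.
move=> u v; rewrite /theta_edge orbC; congr (_ && _).
by case: u v => [a|[i a]] [b|[j b]] //=; rewrite eq_sym.
Qed.

Lemma theta_edge_irrefl (K l : nat) : irreflexive (@theta_edge K l).
Proof. by move=> u; rewrite /theta_edge orbb gtn_eqF ?andbF. Qed.

Definition theta (K l : nat) : sgraph :=
  SGraph (@theta_edge_sym K l) (@theta_edge_irrefl K l).

(* Main.v *)
(* Lower bound: an (r,k)-graph G has at most r k vertices, and at least r^2 / 8
   edges between the union of the first r / 2 classes and the rest.  If such a
   bipartite graph on n vertices had more than C n^(5/4) edges, it would have a
   subgraph of minimum degree larger than C n^(1/4).  Explore it from a vertex x
   in layers N1, ..., N4.  In a theta_{3,4}-free graph the number of edges between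
   two consecutive layers is linear in their sizes (the core of the Faudree-
   Simonovits argument), so that each layer is n^(1/4) times larger than the one
   before, and the fourth has more than n vertices.  Hence r^2 = O((r k)^(5/4)).

   Upper bound: on F^4, F a field of odd order q, join p and l when
     p2 + l2 = p1 l1,  p3 + l4 = p1 l1^2,  p4 + l3 = p1^2 l1.
   For the walks p, a, b, c, p' of length 4 with given ends, the first coordinate
   of b satisfies a nonzero quadratic equation and determines the walk, so there
   are at most two of them and the bipartite double cover is theta_{3,4}-free.
   When q = s^2 write F = U + W, a direct sum of additive groups of order s.
   Points with p1 fixed and (p2, p3, p4) in a coset of W^3, and lines with l1
   fixed and (l2, l3, l4) in a coset of U^3, are always joined by an edge because
   U + W = F; pairing these cells up gives s^5 classes of size 2 s^3. *)
Require Import Defs.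
From mathcomp Require Import all_boot all_order all_algebra all_field.
From mathcomp Require Import all_classical all_reals all_analysis.
From mathcomp Require Import zify ring lra.
Set Implicit Arguments.
Unset Strict Implicit.
Unset Printing Implicit Defensive.
Import Order.TTheory GRing.Theory Num.Theory.
Local Open Scope nat_scope.

(** * Edges between consecutive layers of a theta-free graph *)

(** The ends go to [x] and [y], and the internal vertices of the i-th path to [a i], [b i], [c i];
    the disequalities make this map injective. *)
Lemma free_thetaF (G : sgraph) (x y : G) (a b c : 'I_3 -> G) :
  Defs.free (theta 3 4) G ->
  (forall i, [/\ edge x (a i), edge (a i) (b i), edge (b i) (c i) & edge (c i) y]) ->
  injective a -> injective b -> injective c ->
  (forall i j, a i != b j) -> (forall i j, a i != c j) ->
  (forall i j, b i != c j) ->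
  (forall i, [/\ x != a i, x != b i & x != c i]) ->
  (forall i, [/\ y != a i, y != b i & y != c i]) -> x != y -> False.
Proof.
move=> fr E ia ib ic ab ac bc xs ys xy; apply: fr.
pose phi (v : theta 3 4) : G := match v with
  | inl w => if w then y else x
  | inr (i, j) => match val j with 0 => a i | 1 => b i | _ => c i end end.
exists phi.
- have xs1 i := let: And3 h _ _ := xs i in h.
  have xs2 i := let: And3 _ h _ := xs i in h.
  have xs3 i := let: And3 _ _ h := xs i in h.
  have ys1 i := let: And3 h _ _ := ys i in h.
  have ys2 i := let: And3 _ h _ := ys i in h.
  have ys3 i := let: And3 _ _ h := ys i in h.
  move=> [[]|[i [[|[|[|//]]] hi]]] [[]|[j [[|[|[|//]]] hj]]] //=; rewrite /phi /=;
  first [by move=> /eqP; rewrite ?(negbTE xy) 1?eq_sym ?(negbTE (ab _ _))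
      ?(negbTE (ac _ _)) ?(negbTE (bc _ _)) ?(negbTE (xs1 _)) ?(negbTE (xs2 _))
      ?(negbTE (xs3 _)) ?(negbTE (ys1 _)) ?(negbTE (ys2 _)) ?(negbTE (ys3 _)) ?(negbTE xy)
   | by move=> /eqP; rewrite ?(negbTE xy) ?(negbTE (ab _ _)) ?(negbTE (ac _ _))
      ?(negbTE (bc _ _)) ?(negbTE (xs1 _)) ?(negbTE (xs2 _)) ?(negbTE (xs3 _))
      ?(negbTE (ys1 _)) ?(negbTE (ys2 _)) ?(negbTE (ys3 _))
   | move=> h; congr (inr (_, _)); [first [exact: ia h|exact: ib h|exact: ic h]|exact: val_inj]].
- have E1 i := let: And4 h _ _ _ := E i in h.
  have E2 i := let: And4 _ h _ _ := E i in h.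
  have E3 i := let: And4 _ _ h _ := E i in h.
  have E4 i := let: And4 _ _ _ h := E i in h.
  move=> [[]|[i [[|[|[|//]]] hi]]] [[]|[j [[|[|[|//]]] hj]]] //=;
  rewrite /theta_edge /phi /= ?andbF //=;
  rewrite ?andbT ?orbF ?orbT //;
  by [rewrite edge_sym|move=> /eqP ->|move=> /eqP ->; rewrite edge_sym].
Qed.

(** Greedy choice: at most two elements are already taken at each step. *)
Lemma sdr3 (T : finType) (F : 'I_3 -> {set T}) :
  (forall i, 3 <= #|F i|) ->
  exists2 g : 'I_3 -> T, injective g & forall i, g i \in F i.
Proof.
move=> hF.
have pick (A B : {set T}) : #|B| < #|A| -> exists2 z, z \in A & z \notin B.
  move=> h; have : 0 < #|A :\: B|.
    by rewrite cardsD subn_gt0 (leq_ltn_trans _ h) // subset_leq_card // subsetIr.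
  by case/card_gt0P=> z; rewrite inE => /andP[? ?]; exists z.
pose i1 : 'I_3 := inord 1; pose i2 : 'I_3 := inord 2.
have [u u0 _] : exists2 z, z \in F ord0 & z \notin @finset.set0 T.
  by apply: pick; rewrite finset.cards0; apply: leq_trans (hF _).
have [v v0 vu] : exists2 z, z \in F i1 & z \notin [set u]%SET.
  by apply: pick; rewrite finset.cards1; apply: leq_trans (hF _).
have [w w0 wuv] : exists2 z, z \in F i2 & z \notin [set u; v]%SET.
  by apply: pick; rewrite cards2; apply: leq_trans (hF _); case: (_ != _).
move: vu wuv; rewrite !inE negb_or => vu /andP[wu wv].
exists (fun i : 'I_3 => match val i with 0 => u | 1 => v | _ => w end).
  move=> [[|[|[|//]]] ?] [[|[|[|//]]] ?] //= /eqP h; apply: val_inj => //=;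
  by move: h; rewrite ?(negbTE vu) ?(negbTE wu) ?(negbTE wv) // eq_sym
     ?(negbTE vu) ?(negbTE wu) ?(negbTE wv).
have e1 : i1 = Ordinal (isT : 1 < 3) by apply: val_inj; rewrite /= inordK.
have e2 : i2 = Ordinal (isT : 2 < 3) by apply: val_inj; rewrite /= inordK.
move=> [[|[|[|//]]] h] /=.
- by rewrite (_ : Ordinal h = ord0) //; apply: val_inj.
- by rewrite (_ : Ordinal h = i1) // e1; apply: val_inj.
- by rewrite (_ : Ordinal h = i2) // e2; apply: val_inj.
Qed.

Section Counting.
Variable G : sgraph.
Implicit Types (A B C : {set G}) (x y z : G).

Definition nbr A x : {set G} := [set y in A | edge x y]%SET.

Definition nedges A B : nat := \sum_(x in A) #|nbr B x|.

Lemma in_nbr A x y : (y \in nbr A x) = (y \in A) && edge x y.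
Proof. by rewrite inE. Qed.

Lemma nedgesE A B : nedges A B = \sum_(x in A) \sum_(y in B) edge x y.
Proof.
apply: eq_bigr => x _; rewrite -sum1_card big_mkcond [RHS]big_mkcond /=.
by apply: eq_bigr => y _; rewrite inE; case: (y \in B); case: edge.
Qed.

Lemma nedgesC A B : nedges A B = nedges B A.
Proof.
rewrite !nedgesE exchange_big /=; apply: eq_bigr => y _; apply: eq_bigr => x _.
by rewrite edge_sym.
Qed.

Lemma nedgesUr A B C : nedges A (B :|: C) <= nedges A B + nedges A C.
Proof.
rewrite /nedges -big_split /=; apply: leq_sum => x _.
apply: leq_trans (leq_card_setU _ _); apply: subset_leq_card.
by apply/fintype.subsetP => y; rewrite !inE -andb_orl.
Qed.

(** Deleting a vertex of degree at most [d] loses at most [d] edges, so the strict inequality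
    survives every deletion and keeps the sets nonempty. *)
Lemma min_degree_subgraph d A B : d * (#|A| + #|B|) < nedges A B ->
  exists A' B', [/\ A' \subset A, B' \subset B, A' != finset.set0,
    forall x, x \in A' -> d < #|nbr B' x| & forall y, y \in B' -> d < #|nbr A' y|].
Proof.
have [n] := ubnP (#|A| + #|B|); elim: n A B => // n IH A B hn h.
have [/existsP[x /andP[xA hx]]|/existsPn hA] :=
    boolP [exists x, (x \in A) && (#|nbr B x| <= d)].
  have cA := finset.cardsD1 x A; rewrite xA in cA.
  have [||A' [B' [s1 s2 s3 s4 s5]]] := IH (A :\ x)%SET B; [lia| |].
    move: h; rewrite /nedges (big_setD1 x) //=; nia.
  by exists A', B'; split=> //; apply: fintype.subset_trans s1 _; apply: subD1set.
have [/existsP[x /andP[xB hx]]|/existsPn hB] :=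
    boolP [exists x, (x \in B) && (#|nbr A x| <= d)].
  have cB := finset.cardsD1 x B; rewrite xB in cB.
  have [||A' [B' [s1 s2 s3 s4 s5]]] := IH A (B :\ x)%SET; [lia| |].
    move: h; rewrite nedgesC (nedgesC A) /nedges (big_setD1 x) //=; nia.
  by exists A', B'; split=> //; apply: fintype.subset_trans s2 _; apply: subD1set.
exists A, B; split=> //.
- by apply: contraTneq h => ->; rewrite /nedges big_set0.
- by move=> x xA; move: (hA x); rewrite xA -ltnNge.
- by move=> x xB; move: (hB x); rewrite xB -ltnNge.
Qed.

(* Edges are sorted by the colour [col x] of their end in [A]; each part
   satisfies a linear bound, and a vertex of [B] meets at most [m] parts. *)
Lemma nedges_colors (T : finType) (col : G -> T) (c m : nat) A B :
  (forall p (B' : {set G}), B' \subset B ->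
     nedges [set x in A | col x == p]%SET B' <= c * (#|[set x in A | col x == p]%SET| + #|B'|)) ->
  (forall y, y \in B -> #|[set col x | x in nbr A y]%SET| <= m) ->
  nedges A B <= c * (#|A| + m * #|B|).
Proof.
move=> hp hm.
pose Ap p := [set x in A | col x == p]%SET.
pose cols y := [set col x | x in nbr A y]%SET.
pose Bp p := [set y in B | p \in cols y]%SET.
have eA : #|A| = \sum_p #|Ap p|.
  rewrite -sum1_card (partition_big col predT) //=; apply: eq_bigr => p _.
  by rewrite -sum1_card; apply: eq_bigl => x; rewrite inE.
have eN : nedges A B <= \sum_p nedges (Ap p) (Bp p).
  rewrite /nedges (partition_big col predT) //=; apply: leq_sum => p _.
  rewrite [leqRHS](eq_bigl (fun x => (x \in A) && (col x == p))) => [|x]; last by rewrite inE.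
  apply: leq_sum => x /andP[xA /eqP cx].
  apply: subset_leq_card; apply/fintype.subsetP => y; rewrite !inE => /andP[yB xy].
  rewrite yB xy andbT /=; apply/imsetP; exists x => //.
  by rewrite inE xA edge_sym.
have eB : \sum_p #|Bp p| <= m * #|B|.
  rewrite (eq_bigr (fun p => \sum_(y in B) (p \in cols y))) => [|p _].
    rewrite exchange_big mulnC -sum_nat_const; apply: leq_sum => y yB /=.
    by apply: leq_trans (hm y yB); rewrite -sum1_card [leqRHS]big_mkcond.
  rewrite -sum1_card big_mkcond [RHS]big_mkcond; apply: eq_bigr => y _.
  by rewrite inE; case: (y \in B); case: (p \in cols y).
apply: leq_trans eN _.
apply: leq_trans (_ : _ <= \sum_p c * (#|Ap p| + #|Bp p|)) _.
  apply: leq_sum => p _; apply: hp; apply/fintype.subsetP => y.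
  by rewrite inE => /andP[].
rewrite -big_distrr /= leq_mul2l big_split /= -eA; apply/orP; right.
by rewrite leq_add2l.
Qed.

Hypothesis frG : Defs.free (theta 3 4) G.

Lemma edge_neq x y : edge x y -> x != y.
Proof. by apply: contraTneq => ->; rewrite edge_irrefl. Qed.

Lemma neq_disjoint A B x y : [disjoint A & B] -> x \in A -> y \in B -> x != y.
Proof.
by move=> d xA yB; apply: contraTneq xA => ->; rewrite (disjointFl d).
Qed.

(** In a subgraph of minimum degree at least 6, a vertex [y] of [C] is joined to [x] by three paths
    [x, c, b, a, y]. Six neighbours suffice: the vertices [c] must avoid the three vertices [a],
    which leaves three choices for each. *)
Lemma nedges_level1 x A C : x \notin C -> A \subset [set y | edge x y]%SET ->
  [disjoint A & C] -> nedges A C <= 5 * (#|A| + #|C|).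
Proof.
move=> xC sA dAC; rewrite leqNgt; apply/negP => /min_degree_subgraph.
case=> A' [C' [sA' sC' /finset.set0Pn[a0 a0A] hA hC]].
have : 0 < #|nbr C' a0| by apply: leq_trans (hA _ a0A).
case/card_gt0P=> y; rewrite in_nbr => /andP[yC' _].
have [a ia ha] : exists2 a : 'I_3 -> G, injective a & forall i, a i \in nbr A' y.
  by apply: (sdr3 (F := fun=> nbr A' y)) => i; apply: leq_trans (hC y yC').
have haA i : a i \in A' by have := ha i; rewrite in_nbr => /andP[].
have [b ib hb] : exists2 b : 'I_3 -> G,
    injective b & forall i, b i \in (nbr C' (a i) :\ y)%SET.
  apply: (sdr3 (F := fun i => (nbr C' (a i) :\ y)%SET)) => i.
  by have := finset.cardsD1 y (nbr C' (a i)); have := hA _ (haA i); lia.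
have hbC i : b i \in C' by have := hb i; rewrite !inE => /and3P[].
have [c ic hc] : exists2 c : 'I_3 -> G,
    injective c & forall i, c i \in (nbr A' (b i) :\: [set a i | i : 'I_3])%SET.
  apply: (sdr3 (F := fun i => (nbr A' (b i) :\: [set a i | i : 'I_3])%SET)) => i.
  rewrite cardsD; have := hC _ (hbC i).
  have : #|nbr A' (b i) :&: [set a i | i : 'I_3]%SET| <= 3.
    apply: leq_trans (subset_leq_card (subsetIr _ _)) _.
    by rewrite (leq_trans (leq_imset_card _ _)) // card_ord.
  lia.
have hcA i : c i \in A' by have := hc i; rewrite !inE => /and3P[].
have inA u : u \in A' -> u \in A by apply: (fintype.subsetP sA').
have inC u : u \in C' -> u \in C by apply: (fintype.subsetP sC').
have xA u : u \in A' -> edge x u.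
  by move=> /inA /(fintype.subsetP sA); rewrite inE.
have AC u v : u \in A' -> v \in C' -> u != v.
  by move=> /inA h /inC; apply: neq_disjoint dAC h.
have CA u v : u \in A' -> v \in C' -> v != u by move=> ? ?; rewrite eq_sym AC.
have xC' u : u \in C' -> x != u by move=> /inC; apply: contraTneq => <-.
apply: (@free_thetaF G x y c b a frG) => // [i|i j|i j|i j|i|i|].
- split; first exact: xA.
  + by have := hc i; rewrite !inE edge_sym => /and3P[].
  + by have := hb i; rewrite !inE edge_sym => /and3P[].
  + by have := ha i; rewrite !inE edge_sym => /andP[].
- exact: AC.
- have := hc i; rewrite inE => /andP[h _]; apply: contraNneq h => ->.
  by apply/imsetP; exists j.
- exact: CA.
- by split; [apply/edge_neq/xA|apply: xC'|apply/edge_neq/xA].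
- split; [exact: CA| |exact: CA].
  by have := hb i; rewrite !inE eq_sym => /andP[].
- exact: xC'.
Qed.

(** [p] gives the parent of a vertex, a neighbour of the root [x]. Vertices of [C] seeing at most
    three parents are handled by colouring [A] with [p] and applying [nedges_level1] around each
    parent; the others form [rich], where a vertex of [A] has at most two neighbours. *)
Lemma nedges_level2 x A C (p : G -> G) :
  (forall a, a \in A -> edge x (p a) && edge (p a) a) ->
  (forall a, a \in A -> p a \notin A :|: C) -> x \notin A :|: C ->
  [disjoint A & C] -> nedges A C <= 15 * (#|A| + #|C|).
Proof.
move=> hp pAC xAC dAC.
pose col z := [set p a | a in nbr A z]%SET.
pose rich := [set z in C | 3 < #|col z|]%SET.
have xA a : a \in A -> x != a.
  by apply: contraTneq => <-; move: xAC; rewrite inE negb_or => /andP[].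
have xC a : a \in C -> x != a.
  by apply: contraTneq => <-; move: xAC; rewrite inE negb_or => /andP[].
have pA a b : a \in A -> b \in A -> p a != b.
  by move=> /pAC h; apply: contraTneq => <-; move: h; rewrite inE negb_or => /andP[].
have pC a b : a \in A -> b \in C -> p a != b.
  by move=> /pAC h; apply: contraTneq => <-; move: h; rewrite inE negb_or => /andP[].
(* Three rich neighbours [z] of [y] each see three parents other than [p y]; distinct
   representatives [q] of these give paths [x, q, b, z, y]. *)
have few_rich y : y \in A -> #|nbr rich y| <= 2.
  move=> yA; rewrite leqNgt; apply/negP => h.
  have [z iz hz] : exists2 z : 'I_3 -> G, injective z & forall i, z i \in nbr rich y.
    exact: (sdr3 (F := fun=> nbr rich y)).
  have [q iq hq] : exists2 q : 'I_3 -> G,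
      injective q & forall i, q i \in (col (z i) :\ p y)%SET.
    apply: (sdr3 (F := fun i => (col (z i) :\ p y)%SET)) => i.
    have := hz i; rewrite !inE => /andP[/andP[_ hi] _].
    by have := finset.cardsD1 (p y) (col (z i)); lia.
  have /fin_all_exists[b hb] i : exists b, [/\ b \in nbr A (z i), q i = p b & b != y].
    have := hq i; rewrite 2!inE => /andP[qi /imsetP[b bN e]]; exists b; split=> //.
    by apply: contraNneq qi => <-; rewrite e.
  have bA i : b i \in A by case: (hb i); rewrite inE => /andP[].
  have zC i : z i \in C by have := hz i; rewrite !inE => /andP[/andP[]].
  have qb i : q i = p (b i) by case: (hb i).
  apply: (@free_thetaF G x y q b z frG) => // [i|i j e|i j|i j|i j|i|i|].
  - have := hp _ (bA i); rewrite qb => /andP[-> ->]; split=> //.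
      by case: (hb i) => + _ _; rewrite inE edge_sym => /andP[].
    by have := hz i; rewrite inE edge_sym => /andP[].
  - by apply: iq; rewrite !qb e.
  - by rewrite qb pA.
  - by rewrite qb pC.
  - exact: neq_disjoint dAC (bA i) (zC j).
  - split; [|exact: xA|exact: xC].
    by rewrite qb; apply: edge_neq; case/andP: (hp _ (bA i)).
  - split; first by rewrite qb eq_sym pA.
      by case: (hb i) => _ _; rewrite eq_sym.
    exact: neq_disjoint dAC yA (zC i).
  - exact: xA.
have nrich : nedges A rich <= 2 * #|A|.
  by rewrite mulnC -sum_nat_const; apply: leq_sum => y /few_rich.
have npoor : nedges A (C :\: rich) <= 5 * (#|A| + 3 * #|C :\: rich|).
  apply: (nedges_colors (col := p)) => [q B sB|y].
    have [->|/finset.set0Pn[a]] := eqVneq [set a in A | p a == q]%SET finset.set0.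
      by rewrite /nedges big_set0.
    rewrite inE => /andP[aA /eqP pa].
    have sBC : B \subset C by apply: fintype.subset_trans sB (subsetDl _ _).
    apply: (@nedges_level1 q).
    - rewrite -pa; have := pAC _ aA; rewrite inE negb_or => /andP[_].
      by apply: contra => /(fintype.subsetP sBC).
    - apply/fintype.subsetP => b; rewrite !inE => /andP[bA /eqP <-].
      by case/andP: (hp _ bA).
    - apply: disjointWl (disjointWr sBC dAC).
      by apply/fintype.subsetP => b; rewrite inE => /andP[].
  by rewrite finset.in_setD !inE negb_and -leqNgt => /andP[+ yC]; rewrite yC.
have sub : C = (rich :|: (C :\: rich))%SET.
  by apply/finset.setP => z; rewrite !inE; case: (z \in C) => //=; case: (_ < _).
have le : #|C :\: rich| <= #|C| by rewrite subset_leq_card // subsetDl.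
have := nedgesUr A rich (C :\: rich); rewrite -sub; lia.
Qed.

(** Colour [A] by the grandparent [q]. Each class falls under [nedges_level2] with the grandparent
    as root, and a vertex [y] of [C] meets at most two classes, since three would give paths
    [x, q, p, b, y]. *)
Lemma nedges_level3 x A C (p q : G -> G) :
  (forall a, a \in A -> [&& edge x (q a), edge (q a) (p a) & edge (p a) a]) ->
  (forall a b, a \in A -> b \in A -> q a != p b) ->
  (forall a b, a \in A -> b \in A -> p a = p b -> q a = q b) ->
  (forall a, a \in A -> p a \notin A :|: C) ->
  (forall a, a \in A -> q a \notin A :|: C) ->
  (forall a, a \in A -> x != p a) -> x \notin A :|: C ->
  [disjoint A & C] -> nedges A C <= 30 * (#|A| + #|C|).
Proof.
move=> hpq qp pq pAC qAC xp xAC dAC.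
have xA a : a \in A -> x != a.
  by apply: contraTneq => <-; move: xAC; rewrite inE negb_or => /andP[].
have xC a : a \in C -> x != a.
  by apply: contraTneq => <-; move: xAC; rewrite inE negb_or => /andP[].
have pA a b : a \in A -> b \in A -> p a != b.
  by move=> /pAC h; apply: contraTneq => <-; move: h; rewrite inE negb_or => /andP[].
have pC a b : a \in A -> b \in C -> p a != b.
  by move=> /pAC h; apply: contraTneq => <-; move: h; rewrite inE negb_or => /andP[].
have qA a b : a \in A -> b \in A -> q a != b.
  by move=> /qAC h; apply: contraTneq => <-; move: h; rewrite inE negb_or => /andP[].
have qC a b : a \in A -> b \in C -> q a != b.
  by move=> /qAC h; apply: contraTneq => <-; move: h; rewrite inE negb_or => /andP[].
suff : nedges A C <= 15 * (#|A| + 2 * #|C|) by lia.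
apply: (nedges_colors (col := q)) => [u B sB|y yC].
  have [->|/finset.set0Pn[a0]] := eqVneq [set a in A | q a == u]%SET finset.set0.
    by rewrite /nedges big_set0.
  rewrite inE => /andP[a0A /eqP qa0].
  apply: (@nedges_level2 u _ _ p).
  - by move=> a; rewrite inE => /andP[/hpq/and3P[_ h1 h2] /eqP <-]; rewrite h1.
  - move=> a; rewrite inE => /andP[/pAC h _]; apply: contra h.
    by rewrite !inE => /orP[/andP[-> //]|/(fintype.subsetP sB) ->]; rewrite orbT.
  - rewrite -qa0; apply: contra (qAC _ a0A).
    by rewrite !inE => /orP[/andP[-> //]|/(fintype.subsetP sB) ->]; rewrite orbT.
  - apply: disjointWl (disjointWr sB dAC).
    by apply/fintype.subsetP => b; rewrite inE => /andP[].
rewrite leqNgt; apply/negP => h.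
have [g ig hg] : exists2 g : 'I_3 -> G, injective g &
    forall i, g i \in [set q a | a in nbr A y]%SET.
  exact: (sdr3 (F := fun=> [set q a | a in nbr A y]%SET)).
have /fin_all_exists[b hb] i : exists b, [/\ b \in A, edge b y & g i = q b].
  have := hg i => /imsetP[b]; rewrite inE edge_sym => /andP[? ?] ?.
  by exists b; split.
have bA i : b i \in A by case: (hb i).
have gb i : g i = q (b i) by case: (hb i).
apply: (@free_thetaF G x y g (p \o b) b frG) => // [i|i j e|i j e|i j|i j|i j|i|i|] /=.
- have := hpq _ (bA i) => /and3P[? ? ?]; rewrite gb; split=> //.
  by case: (hb i).
- by apply: ig; rewrite !gb; apply: pq.
- by apply: ig; rewrite !gb e.
- by rewrite gb qp.
- by rewrite gb qA.
- exact: pA.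
- split; [|exact: xp|exact: xA].
  by rewrite gb; apply: edge_neq; case/and3P: (hpq _ (bA i)).
- by split; rewrite eq_sym ?gb ?qC ?pC //; apply: neq_disjoint dAC (bA i) yC.
- exact: xC.
Qed.

End Counting.

(** * Density of theta-free graphs *)

Section Layers.
Variable G : sgraph.
Hypothesis frG : Defs.free (theta 3 4) G.
Implicit Types (A B X Y : {set G}) (x y u v : G).

(** A choice of parent for [v] in the layer [A]; the default [v] is reached only when [v] has no
    neighbour in [A]. *)
Definition neighbor_in A v : G := odflt v [pick u in A | edge u v].

Lemma neighbor_inP A v : [exists u in A, edge u v] ->
  neighbor_in A v \in A /\ edge (neighbor_in A v) v.
Proof.
move=> /exists_inP[u uA uv]; rewrite /neighbor_in; case: pickP => [w /andP[]//|].
by move=> /(_ u); rewrite uA uv.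
Qed.

Lemma leq_nedges d A B Y :
  (forall a, a \in A -> d < #|nbr Y a|) ->
  (forall a v, a \in A -> v \in Y -> edge a v -> v \in B) ->
  d * #|A| <= nedges A B.
Proof.
move=> hd sub; rewrite mulnC -sum_nat_const; apply: leq_sum => a aA.
apply: leq_trans (ltnW (hd a aA)) _; apply: subset_leq_card.
apply/fintype.subsetP => v; rewrite !inE => /andP[vY av].
by rewrite av (sub a v).
Qed.

Lemma nedges_bipartite M X Y : 0 < M -> [disjoint X & Y] -> #|G| < M ^ 4 ->
  nedges X Y <= 30 * (M + 3) * (#|X| + #|Y|).
Proof.
move=> M0 dXY hM; rewrite leqNgt; apply/negP => /min_degree_subgraph.
case=> X' [Y' [sX sY /finset.set0Pn[x xX] hX hY]].
have dXY' : [disjoint X' & Y'] by apply: disjointWl sX (disjointWr sY dXY).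
have nXY u : u \in X' -> u \in Y' = false by move=> h; rewrite (disjointFr dXY').
(* Distance layers from [x], lying alternately in [Y'] and [X']. *)
pose N1 := nbr Y' x.
pose N2 := [set v in X' | (v != x) && [exists u in N1, edge u v]]%SET.
pose N3 := [set v in Y' | (v \notin N1) && [exists u in N2, edge u v]]%SET.
pose N4 := [set v in X' | [&& v != x, v \notin N2 & [exists u in N3, edge u v]]]%SET.
have in1 v : v \in N1 -> v \in Y' by rewrite inE => /andP[].
have in2 v : v \in N2 -> v \in X' by rewrite inE => /andP[].
have in3 v : v \in N3 -> v \in Y' by rewrite inE => /andP[].
have in4 v : v \in N4 -> v \in X' by rewrite inE => /andP[].
have out u v : u \in X' -> v \in Y' -> u != v.
  by move=> uX vY; apply: contraTneq vY => <-; rewrite nXY.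
have out' u v : u \in Y' -> v \in X' -> u != v by move=> ? ?; rewrite eq_sym out.
have nX u A : u \in X' -> (forall v, v \in A -> v \in Y') -> u \notin A.
  by move=> uX sA; apply/negP => /sA; rewrite nXY.
have nY u A : u \in Y' -> (forall v, v \in A -> v \in X') -> u \notin A.
  by move=> uY sA; apply/negP => /sA uX; move: uY; rewrite nXY.
have x2 : x \notin N2 by rewrite !inE eqxx andbF.
have x4 : x \notin N4 by rewrite !inE eqxx andbF.
have dis A B : (forall v, v \in A -> v \in X') -> (forall v, v \in B -> v \in Y') ->
    [disjoint A & B].
  by move=> sA sB; apply: disjointWl (disjointWr _ dXY'); apply/fintype.subsetP.
have par2 v : v \in N2 -> neighbor_in N1 v \in N1 /\ edge (neighbor_in N1 v) v.
  by rewrite inE => /and3P[_ _ /neighbor_inP].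
have par3 v : v \in N3 -> neighbor_in N2 v \in N2 /\ edge (neighbor_in N2 v) v.
  by rewrite inE => /and3P[_ _ /neighbor_inP].
have ex1 v : v \in N1 -> edge x v by rewrite inE => /andP[].
have n31 v : v \in N1 -> v \notin N3 by move=> v1; rewrite !inE -in_nbr v1 andbF.
have n42 v : v \in N2 -> v \notin N4.
  by move=> v2; rewrite finset.in_set v2 /= !andbF.
have e1 : nedges N1 N2 <= 5 * (#|N1| + #|N2|).
  apply: (nedges_level1 frG x2).
    by apply/fintype.subsetP => v; rewrite !inE => /andP[].
  by rewrite disjoint_sym dis.
have e2 : nedges N2 N3 <= 15 * (#|N2| + #|N3|).
  apply: (nedges_level2 frG (x := x) (p := neighbor_in N1)) => [a /par2[h ->]|a /par2[h _]||].
  - by rewrite ex1.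
  - by rewrite inE negb_or n31 // nY // in1.
  - by rewrite inE negb_or x2 nX.
  - exact: dis.
have e3 : nedges N3 N4 <= 30 * (#|N3| + #|N4|).
  apply: (nedges_level3 frG (x := x) (p := neighbor_in N2)
    (q := neighbor_in N1 \o neighbor_in N2)) => [a|a b|a b|a|a|a||] /=.
  - by move=> /par3[/par2[/ex1 -> ->] ->].
  - by move=> /par3[/par2[/in1 h _] _] /par3[/in2 ? _]; apply: out'.
  - by move=> _ _ ->.
  - by move=> /par3[h _]; rewrite inE negb_or n42 // nX // in2.
  - by move=> /par3[/par2[h _] _]; rewrite inE negb_or n31 // nY // in1.
  - by move=> /par3[h _]; apply: contraNneq x2 => ->.
  - by rewrite inE negb_or x4 nX.
  - by rewrite disjoint_sym dis.
have d0 : 30 * (M + 3) < #|N1| by apply: hX.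
have d1 : 30 * (M + 3) * #|N1| <= nedges N1 ([set x] :|: N2)%SET.
  apply: (leq_nedges (Y := X')) => [a /in1/hY //|a v a1 vX av].
  rewrite !inE vX; case: eqP => //= _.
  by apply/exists_inP; exists a.
have d2 : 30 * (M + 3) * #|N2| <= nedges N2 (N1 :|: N3)%SET.
  apply: (leq_nedges (Y := Y')) => [a /in2/hX //|a v a2 vY av].
  rewrite finset.in_setU; case: (boolP (v \in N1)) => //= v1; rewrite finset.in_set vY v1.
  by apply/exists_inP; exists a.
have d3 : 30 * (M + 3) * #|N3| <= nedges N3 (N2 :|: N4)%SET.
  apply: (leq_nedges (Y := X')) => [a /in3/hY //|a v a3 vX av].
  rewrite finset.in_setU; case: (boolP (v \in N2)) => //= v2; rewrite finset.in_set vX v2.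
  apply/and3P; split=> //; last by apply/exists_inP; exists a.
  (* A vertex of [N3] adjacent to [x] would lie in [N1]. *)
  apply: contraTneq a3 => vx; apply/negP => a3.
  have : a \in N1 by rewrite inE (in3 _ a3) -vx edge_sym.
  by move/n31; rewrite a3.
have ex : nedges N1 [set x]%SET <= #|N1|.
  rewrite nedgesC /nedges big_set1; apply: subset_leq_card.
  by apply/fintype.subsetP => v; rewrite inE => /andP[].
have := nedgesUr N1 [set x]%SET N2; have := nedgesUr N2 N1 N3.
have := nedgesUr N3 N2 N4; rewrite (nedgesC N2 N1) (nedgesC N3 N2) => u3 u2 u1.
(* Of the degree [30 * (M + 3)], the part 90 absorbs the edges going back and the share of the layer
   itself in the linear bounds; [30 * M] remains against a coefficient at most 30 of the next
   layer. *)
have m1 : M * #|N1| <= #|N2| by nia.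
have l1 : #|N1| <= #|N2| by nia.
have m2 : M * #|N2| <= #|N3| by nia.
have l2 : #|N2| <= #|N3| by nia.
have m3 : M * #|N3| <= #|N4| by nia.
have m0 : M <= #|N1| by lia.
have : M ^ 4 <= #|N4|.
  rewrite !expnS expn0 muln1.
  apply: leq_trans m3; rewrite leq_mul2l; apply/orP; right.
  apply: leq_trans m2; rewrite leq_mul2l; apply/orP; right.
  by apply: leq_trans m1; rewrite leq_mul2l m0 orbT.
by rewrite leqNgt (leq_ltn_trans (max_card _) hM).
Qed.

End Layers.

(** * Lower bound: from edge density to class size *)

Lemma card_ord_ltn (r h : nat) : h <= r -> #|[set i : 'I_r | i < h]%SET| = h.
Proof.
move=> hr; rewrite -sum1_card (eq_bigl (fun i : 'I_r => i < h)) => [|i]; last by rewrite inE.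
by rewrite -(big_ord_widen _ (fun=> 1) hr) sum1_card card_ord.
Qed.

Lemma rk_graph_leq (r k : nat) (G : sgraph) : 1 < r -> rk_graph r k G ->
  Defs.free (theta 3 4) G -> r ^ 3 <= 1200 ^ 4 * k ^ 5.
Proof.
move=> r1 [V [covV disV cardV edgeV]] frG.
have /fin_all_exists[cl hcl] (x : G) : exists i, x \in V i.
  have : x \in \bigcup_(i < r) V i by rewrite covV inE.
  by case/bigcupP=> i _; exists i.
have clE x i : x \in V i -> cl x = i.
  move=> xi; apply/eqP; apply: contraTT xi => ne.
  by rewrite (disjointFr (disV _ _ ne)) // hcl.
have cardG : #|G| <= r * k.
  rewrite -sum1_card (partition_big cl predT) //=.
  apply: leq_trans (_ : _ <= \sum_(i < r) k) _; last by rewrite sum_nat_const card_ord.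
  apply: leq_sum => i _.
  apply: leq_trans (cardV i); rewrite sum1_card; apply: subset_leq_card.
  by apply/fintype.subsetP => x /eqP/val_inj <-.
pose h := r./2.
pose X := [set x : G | cl x < h]%SET.
pose L := [set i : 'I_r | i < h]%SET.
have many : r ^ 2 <= 8 * nedges X (~: X)%SET.
  pose E := [set p : G * G | [&& p.1 \in X, p.2 \notin X & edge p.1 p.2]]%SET.
  have cE : #|E| = nedges X (~: X)%SET.
    rewrite nedgesE pair_big_dep /= -sum1_card big_mkcond [RHS]big_mkcond /=.
    apply: eq_bigr => -[x y] _; rewrite !inE /=.
    by case: (_ < h); case: (_ < h); case: edge.
  (* Sending an edge to the classes of its ends maps [E] onto a set containing all these pairs. *)
  have : #|finset.setX L (~: L)%SET| <= #|E|.
    apply: leq_trans (leq_imset_card (fun p => (cl p.1, cl p.2)) E).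
    apply: subset_leq_card; apply/fintype.subsetP => -[i j].
    rewrite !inE /= => /andP[ih jh].
    have ij : i != j by apply: contraNneq jh => <-.
    have [x [y [xi yj xy]]] := edgeV i j ij.
    apply/imsetP; exists (x, y); last by rewrite /= (clE _ _ xi) (clE _ _ yj).
    by rewrite !inE /= (clE _ _ xi) (clE _ _ yj) ih jh.
  have hL : #|L| = h by apply: card_ord_ltn; rewrite /h; lia.
  have := cardsC L; rewrite hL card_ord => hC.
  rewrite cardsX hL cE; have : r = odd r + h.*2 by rewrite odd_double_half.
  by case: (odd r); nia.
have n0 : 0 < #|G|.
  rewrite lt0n; apply/eqP => G0; move: many; rewrite /nedges big1 ?muln0 //.
    by rewrite leqn0 expn_eq0 /= andbT; lia.
  by move=> x; have := fintype0 x G0.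
have exM : exists M, #|G| < M ^ 4.
  by exists #|G|.+1; rewrite (leq_trans (ltnSn _)) // -{1}[_.+1]expn1 leq_pexp2l.
(* By minimality the new [M] is the integer part of the fourth root of [#|G|]. *)
case: (ex_minnP exM) => -[|M] hM minM; first by rewrite exp0n in hM.
have M4 : M ^ 4 <= #|G| by rewrite leqNgt; apply/negP => /minM; rewrite ltnn.
have M0 : 0 < M by case: M hM {minM M4} => //; rewrite exp1n; lia.
have dX : [disjoint X & ~: X]%SET by rewrite -finset.setI_eq0 finset.setICr.
have := nedges_bipartite frG (ltn0Sn M) dX hM; rewrite cardsC => few.
(* [1200 = 8 * 30 * 5], using [M.+1 + 3 <= 5 * M]. *)
set B := 1200.
have le2 : r ^ 2 <= B * (M * #|G|).
  by rewrite (leq_trans many) // /B; nia.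
(* Fourth power of [le2], with [M ^ 4 <= #|G|] and [#|G| <= r * k]; afterwards [r ^ 5] cancels. *)
have le8 : r ^ 8 <= B ^ 4 * (r * k) ^ 5.
  rewrite (expnM r 2 4); apply: leq_trans (_ : (B * (M * #|G|)) ^ 4 <= _).
    by rewrite leq_exp2r.
  rewrite expnMn leq_mul2l; apply/orP; right.
  rewrite expnMn; apply: leq_trans (_ : #|G| ^ 5 <= _); last by rewrite leq_exp2r.
  by rewrite [leqRHS]expnS leq_mul2r M4 orbT.
move: le8; rewrite expnMn (expnD r 3 5) mulnCA mulnC leq_pmul2l //.
by rewrite expn_gt0; apply/orP; left; lia.
Qed.

(** * A theta-free graph over a field of odd order *)

Section MonomialGraph.
Variable F : fieldType.
Local Open Scope ring_scope.
Implicit Types p q : F * F * F * F.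

(** The crossed indices in the last two equations make the relation symmetric, so points and lines
    can share one type. *)
Definition adj p q : bool :=
  let: (p1, p2, p3, p4) := p in let: (q1, q2, q3, q4) := q in
  [&& p2 + q2 == p1 * q1, p3 + q4 == p1 * q1 ^+ 2 & p4 + q3 == p1 ^+ 2 * q1].

Lemma adj_sym p q : adj p q = adj q p.
Proof.
case: p q => [[[p1 p2] p3] p4] [[[q1 q2] q3] q4]; rewrite /adj.
rewrite (addrC p2) (mulrC p1 q1) (addrC p3) (mulrC p1 (_ ^+ _)) (addrC p4) (mulrC (_ ^+ 2) q1).
by congr (_ && _); rewrite andbC.
Qed.

Definition abscissa p : F := p.1.1.1.

Lemma adj_inj p q q' : adj p q -> adj p q' -> abscissa q = abscissa q' -> q = q'.
Proof.
case: p q q' => [[[p1 p2] p3] p4] [[[q1 q2] q3] q4] [[[r1 r2] r3] r4].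
rewrite /adj /abscissa /= => /and3P[/eqP a1 /eqP a2 /eqP a3] /and3P[/eqP b1 /eqP b2 /eqP b3] e.
subst r1; congr (_, _, _, _).
- by apply: (addrI p2); rewrite a1.
- by apply: (addrI p4); rewrite a3.
- by apply: (addrI p3); rewrite a2.
Qed.

(** Read [p], [b], [q] as points and [a], [c] as lines: alternating sums of the equations along the
    walk cancel all other coordinates of [a], [b], [c]. *)
Lemma adj_walk4 p a b c q : adj p a -> adj a b -> adj b c -> adj c q ->
  [/\ p.1.1.2 - q.1.1.2 = (abscissa p - abscissa b) * abscissa a
        + (abscissa b - abscissa q) * abscissa c,
      p.1.2 - q.1.2 = (abscissa p - abscissa b) * abscissa a ^+ 2
        + (abscissa b - abscissa q) * abscissa c ^+ 2
    & p.2 - q.2 = (abscissa p ^+ 2 - abscissa b ^+ 2) * abscissa a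
        + (abscissa b ^+ 2 - abscissa q ^+ 2) * abscissa c].
Proof.
rewrite (adj_sym a b) (adj_sym c q).
case: p a b c q => [[[p1 p2] p3] p4] [[[a1 a2] a3] a4]
  [[[b1 b2] b3] b4] [[[c1 c2] c3] c4] [[[q1 q2] q3] q4].
rewrite /adj /abscissa /=.
move=> /and3P[/eqP h1 /eqP h2 /eqP h3] /and3P[/eqP h4 /eqP h5 /eqP h6].
move=> /and3P[/eqP h7 /eqP h8 /eqP h9] /and3P[/eqP h10 /eqP h11 /eqP h12].
split.
- rewrite !mulrBl -h1 -h4 -h7 -h10; ring.
- rewrite !mulrBl -h2 -h5 -h8 -h11; ring.
- rewrite !mulrBl -h3 -h6 -h9 -h12; ring.
Qed.

Lemma quadratic_eq0 (k2 k1 k0 y1 y2 y3 : F) :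
  y1 != y2 -> y1 != y3 -> y2 != y3 ->
  k2 * y1 ^+ 2 + k1 * y1 + k0 = 0 -> k2 * y2 ^+ 2 + k1 * y2 + k0 = 0 ->
  k2 * y3 ^+ 2 + k1 * y3 + k0 = 0 -> [/\ k2 = 0, k1 = 0 & k0 = 0].
Proof.
rewrite -subr_eq0 => n12; rewrite -subr_eq0 => n13; rewrite -subr_eq0 => n23 r1 r2 r3.
have s12 : k2 * (y1 + y2) + k1 = 0.
  apply: (mulfI n12); rewrite mulr0 -[RHS](subrr 0) -{1}r1 -r2; ring.
have s13 : k2 * (y1 + y3) + k1 = 0.
  apply: (mulfI n13); rewrite mulr0 -[RHS](subrr 0) -{1}r1 -r3; ring.
have k20 : k2 = 0.
  apply: (mulfI n23); rewrite mulr0 -[RHS](subrr 0) -{1}s12 -s13; ring.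
have k10 : k1 = 0 by move: s12; rewrite k20 mul0r add0r.
by split=> //; move: r1; rewrite k20 k10 !mul0r !add0r.
Qed.

(* [x], [y], [z] are the abscissae of the ends and of the middle of a walk of
   length 4, and [u], [v] those of its other two vertices. *)
Definition walk4_eqs (x z d2 d3 d4 y u v : F) : Prop :=
  [/\ d2 = (x - y) * u + (y - z) * v, d3 = (x - y) * u ^+ 2 + (y - z) * v ^+ 2,
      d4 = (x ^+ 2 - y ^+ 2) * u + (y ^+ 2 - z ^+ 2) * v
    & [/\ y != x, y != z & u != v]].

(** Here [d2 = (x - y) * (u - v)] is nonzero, and the quotients [d4 / d2 = x + y] and
    [d3 / d2 = u + v] recover [y] and then, after halving, [u]. *)
Lemma walk4_closed (x d2 d3 d4 y u v y' u' v' : F) : 2%:R != 0 :> F ->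
  walk4_eqs x x d2 d3 d4 y u v -> walk4_eqs x x d2 d3 d4 y' u' v' ->
  y = y' /\ u = u'.
Proof.
move=> two [e2 e3 e4 [nx _ nuv]] [e2' e3' e4' [nx' _ nuv']].
have nz : d2 != 0.
  have -> : d2 = (x - y) * (u - v) by rewrite e2; ring.
  by rewrite mulf_neq0 // subr_eq0 // eq_sym.
have yy : y = y'.
  have h1 : (x + y) * d2 = d4 by rewrite e2 e4; ring.
  have h2 : (x + y') * d2 = d4 by rewrite e2' e4'; ring.
  by apply: (addrI x); apply: (mulIf nz); rewrite h1.
split=> //; subst y'.
have s : u + v = u' + v'.
  apply: (mulIf nz).
  by transitivity d3; [rewrite e3 e2|rewrite e3' e2']; ring.
have nxy : x - y != 0 by rewrite subr_eq0 eq_sym.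
have d : u - v = u' - v'.
  apply: (mulfI nxy).
  by transitivity d2; [rewrite e2|rewrite e2']; ring.
apply: (mulfI two); transitivity ((u + v) + (u - v)); first by ring.
by rewrite s d; ring.
Qed.

(** The identity [d4 - (y + z) * d2 = (x - y) * (x - z) * u] has nonzero factors before [u]. *)
Lemma walk4_open_middle (x z d2 d3 d4 y u v u' v' : F) : x != z ->
  walk4_eqs x z d2 d3 d4 y u v -> walk4_eqs x z d2 d3 d4 y u' v' -> u = u'.
Proof.
move=> nxz [e2 e3 e4 [nx nz nuv]] [e2' e3' e4' _].
have n1 : x - y != 0 by rewrite subr_eq0 eq_sym.
have n2 : x - z != 0 by rewrite subr_eq0.
apply: (mulfI n1); apply: (mulfI n2).
by transitivity (d4 - (y + z) * d2); [rewrite e4 e2|rewrite e4' e2']; ring.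
Qed.

(* Eliminating [u] and [v] leaves a quadratic equation for [y], because the
   cubic terms cancel; it can only vanish identically when [u = v]. *)
Lemma walk4_open (x z d2 d3 d4 y1 u1 v1 y2 u2 v2 y3 u3 v3 : F) : x != z ->
  walk4_eqs x z d2 d3 d4 y1 u1 v1 -> walk4_eqs x z d2 d3 d4 y2 u2 v2 ->
  walk4_eqs x z d2 d3 d4 y3 u3 v3 ->
  [\/ y1 = y2, y1 = y3 | y2 = y3].
Proof.
move=> nxz w1 w2 w3.
have nD : x - z != 0 by rewrite subr_eq0.
(* Chosen so that [(x - y) * u] and [(y - z) * v] become affine functions of [y]. *)
pose g := d2 / (x - z); pose e := (d4 - z * d2) / (x - z).
have m_eq y u v : walk4_eqs x z d2 d3 d4 y u v ->
    (x - y) * u = e - g * y /\ (y - z) * v = g * (x - z + y) - e.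
  move=> [e2 e3 e4 _].
  have h : (x - y) * u = e - g * y.
    by rewrite /e /g e2 e4; field.
  split=> //; have -> : (y - z) * v = d2 - (x - y) * u by rewrite e2; ring.
  by rewrite h /g; field.
(* Coefficients of the equation for [d3] multiplied by [(x - y) * (y - z)]. *)
pose k2 := - g ^+ 2 * z - 2%:R * e * g + g ^+ 2 * x - 2%:R * g * (g * (x - z) - e) + d3.
pose k1 := e ^+ 2 + 2%:R * e * g * z + 2%:R * g * (g * (x - z) - e) * x
  - (g * (x - z) - e) ^+ 2 - d3 * (x + z).
pose k0 := - e ^+ 2 * z + (g * (x - z) - e) ^+ 2 * x + d3 * x * z.
have quad y : k2 * y ^+ 2 + k1 * y + k0 =
    (e - g * y) ^+ 2 * (y - z) + (g * (x - z + y) - e) ^+ 2 * (x - y)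
    - d3 * (x - y) * (y - z).
  by rewrite /k2 /k1 /k0; ring.
have root_y y u v : walk4_eqs x z d2 d3 d4 y u v -> k2 * y ^+ 2 + k1 * y + k0 = 0.
  move=> w; have [h1 h2] := m_eq _ _ _ w; case: w => _ e3 _ _.
  by rewrite quad -h1 -h2 e3; ring.
case: (eqVneq y1 y2) => [|n12]; first by constructor 1.
case: (eqVneq y1 y3) => [|n13]; first by constructor 2.
case: (eqVneq y2 y3) => [|n23]; first by constructor 3.
have [k20 k10 k00] :=
  quadratic_eq0 n12 n13 n23 (root_y _ _ _ w1) (root_y _ _ _ w2) (root_y _ _ _ w3).
(* At [y = x] what remains is [(e - g * x) ^+ 2 * (x - z) = 0]; then [e = g * x] forces both [u1]
   and [v1] to equal [g]. *)
have := quad x; rewrite k20 k10 k00 !mul0r !addr0 subrr !mulr0 mul0r subr0 addr0.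
move=> /esym/eqP; rewrite mulf_eq0 (negbTE nD) orbF sqrf_eq0 subr_eq0 => /eqP ex.
have [h1 h2] := m_eq _ _ _ w1; case: w1 => _ _ _ [nx nz /eqP[]].
have u1g : u1 = g.
  have n1 : x - y1 != 0 by rewrite subr_eq0 eq_sym.
  by apply: (mulfI n1); rewrite h1 ex; ring.
have n2 : y1 - z != 0 by rewrite subr_eq0.
by rewrite u1g; apply: (mulfI n2); rewrite h2 ex; ring.
Qed.

(** The abscissa of [b i] determines that of [a i], and by [adj_inj] the two determine [b i]. Three
    walks would therefore need three distinct middle abscissae, one more than the quadratic equation
    allows. *)
Lemma adj_no_three_walks (p q : F * F * F * F) (a b c : 'I_3 -> F * F * F * F) :
  2%:R != 0 :> F ->
  (forall i, [/\ adj p (a i), adj (a i) (b i), adj (b i) (c i) & adj (c i) q]) ->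
  (forall i, [/\ p != b i, b i != q & a i != c i]) -> p != q -> injective b -> False.
Proof.
move=> two W N pq ib.
have E1 i : adj p (a i) by case: (W i).
have E2 i : adj (a i) (b i) by case: (W i).
have E3 i : adj (b i) (c i) by case: (W i).
have E4 i : adj (c i) q by case: (W i).
pose w i := walk4_eqs (abscissa p) (abscissa q) (p.1.1.2 - q.1.1.2)
  (p.1.2 - q.1.2) (p.2 - q.2) (abscissa (b i)) (abscissa (a i)) (abscissa (c i)).
have hw i : w i.
  have [e2 e3 e4] := adj_walk4 (E1 i) (E2 i) (E3 i) (E4 i); split=> //.
  have [n1 n2 n3] := N i; split.
  - apply: contra n1 => /eqP e; apply/eqP; apply: (@adj_inj (a i)) => //.
    by rewrite adj_sym.
  - apply: contra n2 => /eqP e; apply/eqP; apply: (@adj_inj (c i)) => //.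
    by rewrite adj_sym.
  - apply: contra n3 => /eqP e; apply/eqP; apply: (@adj_inj (b i)) => //.
    by rewrite adj_sym.
have same i j : abscissa (b i) = abscissa (b j) -> abscissa (a i) = abscissa (a j) -> i = j.
  move=> eb ea; apply: ib; have aa : a i = a j by apply: adj_inj (E1 i) (E1 j) ea.
  by apply: adj_inj (E2 i) _ eb; rewrite aa.
have [i01 [i02 i12]] : (inord 0 : 'I_3) != inord 1 /\ (inord 0 : 'I_3) != inord 2
    /\ (inord 1 : 'I_3) != inord 2.
  by rewrite -!val_eqE /= !inordK.
have key i j : i != j -> abscissa (b i) != abscissa (b j).
  move=> /eqP ij; apply/eqP => eb; apply: ij; apply: same => //.
  have wi := hw i; have wj := hw j; rewrite /w in wi wj.
  have [epq|npq] := eqVneq (abscissa p) (abscissa q).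
    by rewrite epq in wi wj; case: (walk4_closed two wi wj).
  by rewrite eb in wi; apply: walk4_open_middle npq wi wj.
have [epq|npq] := eqVneq (abscissa p) (abscissa q).
  have w0 := hw (inord 0); have w1 := hw (inord 1); rewrite /w epq in w0 w1.
  by case: (walk4_closed two w0 w1) => /eqP; rewrite (negbTE (key _ _ i01)).
by case: (walk4_open npq (hw (inord 0)) (hw (inord 1)) (hw (inord 2))) => /eqP;
  apply/negP; apply: key.
Qed.

End MonomialGraph.

(** * Splitting a field of order s^2 into two additive subgroups of order s *)

Section Splitting.
Variables (F : finFieldType) (m : nat).
Hypotheses (pF : 3 \in [pchar F]%R) (cardF : #|F| = (3 ^ m) ^ 2).
Local Open Scope ring_scope.

Let s := (3 ^ m)%N.

Let s_gt0 : (0 < s)%N. Proof. by rewrite expn_gt0. Qed.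

Let three0 : 3%:R = 0 :> F. Proof. by have := pcharf0 pF. Qed.

Lemma two_neq0 : 2%:R != 0 :> F.
Proof.
apply: contraNneq (oner_neq0 F) => h.
by rewrite -(addrK 2%:R 1) -[X in X - _](natrD _ 1 2) three0 h subr0.
Qed.

Let powD (x y : F) : (x + y) ^+ s = x ^+ s + y ^+ s.
Proof.
by apply: exprDn_pchar; rewrite (eq_pnat _ (pcharf_eq pF)) pnatX pnat_id.
Qed.

Let powN (x : F) : (- x) ^+ s = - x ^+ s.
Proof.
apply: (addrI (x ^+ s)); rewrite -powD !subrr expr0n.
by rewrite (gtn_eqF s_gt0).
Qed.

Let powK (x : F) : (x ^+ s) ^+ s = x.
Proof. by rewrite -exprM -[(s * s)%N]/(s ^ 2)%N -cardF expf_card. Qed.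

Let W (e : F) : {set F} := [set x | x ^+ s == e * x]%SET.

(** The elements of [W e] are roots of a polynomial whose degree is [s] because [1 < s]. *)
Let card_W e : (1 < s)%N -> (#|W e| <= s)%N.
Proof.
move=> s1; pose P : {poly F} := 'X^s - e *: 'X.
have sz : size P = s.+1.
  rewrite size_polyDl size_polyXn // size_polyN (leq_ltn_trans (size_scale_leq _ _)) //.
  by rewrite size_polyX.
rewrite -ltnS -sz cardE; apply: max_poly_roots.
- by rewrite -size_poly_eq0 sz.
- apply/allP => x; rewrite mem_enum inE => /eqP h.
  by rewrite rootE !hornerE h subrr.
- exact: enum_uniq.
Qed.

(* [F] is the direct sum of the eigenspaces of [x |-> x ^+ s] for the
   eigenvalues 1 and -1, both of cardinality [s]. *)
Lemma splitting : (0 < m)%N -> exists eu ew : 'I_(3 ^ m) -> F,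
  bijective (fun ij : 'I_(3 ^ m) * 'I_(3 ^ m) => eu ij.1 + ew ij.2).
Proof.
move=> m0; have s1 : (1 < s)%N by rewrite -{1}(expn0 3) ltn_exp2l.
pose add (p : F * F) := p.1 + p.2.
have onto : [set: F]%SET = add @: finset.setX (W (-1)) (W 1).
  apply/esym/eqP; rewrite -finset.subTset; apply/fintype.subsetP => x _; apply/imsetP.
  (* The two entries sum to [- 2 x], which is [x] in characteristic 3. *)
  exists (x ^+ s - x, - (x + x ^+ s)).
    rewrite !inE /= powD powN powK powN powD powK mulN1r mul1r opprB eqxx /=.
    by rewrite addrC.
  apply/eqP; rewrite -subr_eq0; apply/eqP.
  by transitivity (3%:R * x); [rewrite /add /=; ring|rewrite three0 mul0r].
have c1 := card_W 1 s1; have c2 := card_W (-1) s1.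
have le : (#|F| <= #|W (-1)%R| * #|W 1%R|)%N.
  by rewrite -cardsX -cardsT onto leq_imset_card.
(* Two factors at most [s] whose product is at least [s ^ 2]. *)
have [w1 u1] : #|W 1| = s /\ #|W (-1)| = s.
  by move: le; rewrite cardF -/s; nia.
exists (fun i => enum_val (cast_ord (esym u1) i)), (fun i => enum_val (cast_ord (esym w1) i)).
set h := (h in bijective h).
suff ih : injective h.
  by apply: (inj_card_bij ih); rewrite cardF card_prod card_ord.
move=> [i j] [i' j']; rewrite /h /=.
set a := enum_val _; set b := enum_val _; set a' := enum_val _; set b' := enum_val _.
move=> ab.
have inU k : (enum_val (cast_ord (esym u1) k)) ^+ s = - enum_val (cast_ord (esym u1) k).
  by have := enum_valP (cast_ord (esym u1) k); rewrite inE mulN1r => /eqP.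
have inW k : (enum_val (cast_ord (esym w1) k)) ^+ s = enum_val (cast_ord (esym w1) k).
  by have := enum_valP (cast_ord (esym w1) k); rewrite inE mul1r => /eqP.
(* The common difference lies in both eigenspaces, hence equals its own negative. *)
have d : a - a' = b' - b by apply: (addIr b); rewrite addrAC ab; ring.
have d0 : a - a' = 0.
  have dU : (a - a') ^+ s = - (a - a') by rewrite powD powN !inU opprD.
  have dW : (a - a') ^+ s = a - a' by rewrite d powD powN !inW.
  by apply: (mulfI two_neq0); rewrite mulr0 mulr_natl mulr2n -{1}dW dU addNr.
congr (_, _).
- apply: (@cast_ord_inj _ _ (esym u1)); apply: enum_val_inj; apply/eqP.
  by rewrite -subr_eq0 -/a -/a' d0.
- apply: (@cast_ord_inj _ _ (esym w1)); apply: enum_val_inj; apply/eqP.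
  by rewrite eq_sym -subr_eq0 -/b -/b' -d d0.
Qed.

End Splitting.

(** * Covering all pairs of classes *)

Section Construction.
Variables (F : finFieldType) (s r : nat) (eu ew : 'I_s -> F).
Hypothesis two : (2%:R != 0 :> F)%R.
Hypothesis split_bij :
  bijective (fun ij : 'I_s * 'I_s => eu ij.1 + ew ij.2)%R.
(** [code i] holds an abscissa and three coset representatives, shared by the point cell and the
    line cell that form class [i]. *)
Variable code : 'I_r -> F * ('I_s * 'I_s * 'I_s).
Hypothesis code_inj : injective code.
Local Open Scope ring_scope.

(* [(i, b, t)] is a point ([b = false]) or a line ([b = true]) of the bipartite
   graph with adjacency [adj]; the [t]'s run through a coset of a product of
   copies of the range of [ew] or [eu] respectively. *)
Definition cell_vertex : finType := ('I_r * bool * ('I_s * 'I_s * 'I_s))%type.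

Definition cell_coord (b : bool) (i j : 'I_s) : F :=
  if b then eu j + ew i else eu i + ew j.

Definition place (v : cell_vertex) : F * F * F * F :=
  let: (i, b, (t1, t2, t3)) := v in
  let: (x, (a1, a2, a3)) := code i in
  (x, cell_coord b a1 t1, cell_coord b a2 t2, cell_coord b a3 t3).

(** The bipartite double cover: requiring opposite sides removes the loops of [adj], and [place] is
    injective on each side. *)
Definition cell_edge : rel cell_vertex :=
  fun u v => (u.1.2 != v.1.2) && adj (place u) (place v).

Lemma cell_edge_sym : symmetric cell_edge.
Proof. by move=> u v; rewrite /cell_edge eq_sym adj_sym. Qed.

Lemma cell_edge_irrefl : irreflexive cell_edge.
Proof. by move=> u; rewrite /cell_edge eqxx. Qed.

Definition cell_graph : sgraph := SGraph cell_edge_sym cell_edge_irrefl.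

Lemma cell_coord_inj b i j i' j' : cell_coord b i j = cell_coord b i' j' -> (i, j) = (i', j').
Proof.
have inj := bij_inj split_bij.
case: b; rewrite /cell_coord => e; last exact: (inj (i, j) (i', j')).
by have [-> ->] := inj (j, i) (j', i') e.
Qed.

Lemma place_inj (u v : cell_vertex) : u.1.2 = v.1.2 -> place u = place v -> u = v.
Proof.
case: u v => [[i b] [[t1 t2] t3]] [[i' b'] [[t1' t2'] t3']] /= <-.
case E: (code i) => [x [[a1 a2] a3]]; case E': (code i') => [x' [[a1' a2'] a3']].
move=> [ex /cell_coord_inj[e1 ->] /cell_coord_inj[e2 ->] /cell_coord_inj[e3 ->]].
by congr (_, _, _); apply: code_inj; rewrite E E' ex e1 e2 e3.
Qed.

Lemma cell_graph_rk : rk_graph r (2 * s ^ 3) cell_graph.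
Proof.
exists (fun i => [set v : cell_vertex | v.1.1 == i]%SET); split.
- apply/finset.setP => v; rewrite inE; apply/bigcupP; exists v.1.1 => //.
  by rewrite inE.
- move=> i j ij; rewrite -finset.setI_eq0; apply/eqP/finset.setP => v; rewrite !inE.
  by case: eqP => // ->; apply/negbTE.
- move=> i; pose h (v : cell_vertex) := (v.1.2, v.2).
  have -> : (2 * s ^ 3)%N = #|{: bool * ('I_s * 'I_s * 'I_s)}|.
    by rewrite !card_prod card_bool !card_ord !expnS expn0 muln1 !mulnA.
  rewrite -(@card_in_imset _ _ h) ?max_card //.
  move=> [[i1 b1] t1] [[i2 b2] t2]; rewrite !inE /h /= => /eqP -> /eqP ->.
  by case=> -> ->.
- move=> i j ij.
  have onto z : exists t, eu t.1 + ew t.2 = z.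
    by case: split_bij => g _ gK; exists (g z); apply: gK.
  case E: (code i) => [x [[a1 a2] a3]]; case E': (code j) => [y [[b1 b2] b3]].
  (* Each equation of [adj] asks for one line parameter in U plus one point parameter in W with a
     prescribed sum; the indices cross as they do in [adj]. *)
  have [[v1 u1] /= h1] := onto (x * y - eu a1 - ew b1).
  have [[v3 u2] /= h2] := onto (x * y ^+ 2 - eu a2 - ew b3).
  have [[v2 u3] /= h3] := onto (x ^+ 2 * y - eu a3 - ew b2).
  exists (i, false, (u1, u2, u3)), (j, true, (v1, v2, v3)).
  rewrite !inE !eqxx; split=> //=.
  rewrite /cell_edge /= E E' /cell_coord /=.
  apply/and3P; split; apply/eqP.
  + transitivity (eu v1 + ew u1 + eu a1 + ew b1); first by ring.
    by rewrite h1; ring.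
  + transitivity (eu v3 + ew u2 + eu a2 + ew b3); first by ring.
    by rewrite h2; ring.
  + transitivity (eu v2 + ew u3 + eu a3 + ew b2); first by ring.
    by rewrite h3; ring.
Qed.

Lemma cell_graph_free : Defs.free (theta 3 4) cell_graph.
Proof.
move=> [phi iphi ephi].
pose x : theta 3 4 := inl false; pose y : theta 3 4 := inl true.
pose a i : theta 3 4 := inr (i, Ordinal (isT : 0 < 3)%N).
pose b i : theta 3 4 := inr (i, Ordinal (isT : 1 < 3)%N).
pose c i : theta 3 4 := inr (i, Ordinal (isT : 2 < 3)%N).
have E i : [/\ cell_edge (phi x) (phi (a i)), cell_edge (phi (a i)) (phi (b i)),
    cell_edge (phi (b i)) (phi (c i)) & cell_edge (phi (c i)) (phi y)].
  by split; apply: ephi; rewrite /= /theta_edge /= ?eqxx.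
(* Two steps return to the same side, so [place] separates [x], [y] and the [b i], and also [a i]
   from [c i]. *)
have flip u v w : cell_edge u v -> cell_edge v w -> u.1.2 = w.1.2.
  by move=> /andP[+ _] /andP[+ _]; case: u.1.2; case: v.1.2; case: w.1.2.
have sxb i : (phi x).1.2 = (phi (b i)).1.2 by case: (E i) => + + _ _; apply: flip.
have sby i : (phi (b i)).1.2 = (phi y).1.2 by case: (E i) => _ _; apply: flip.
have sac i : (phi (a i)).1.2 = (phi (c i)).1.2 by case: (E i) => _ + + _; apply: flip.
have ne u v : (phi u).1.2 = (phi v).1.2 -> u <> v -> place (phi u) != place (phi v).
  by move=> e uv; apply/eqP => /(place_inj e)/iphi.
apply: (@adj_no_three_walks F (place (phi x)) (place (phi y))
  (place \o phi \o a) (place \o phi \o b) (place \o phi \o c) two) => [i|i||i j /=].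
- by case: (E i) => /andP[_ ?] /andP[_ ?] /andP[_ ?] /andP[_ ?].
- by split; [apply: (ne x (b i))|apply: (ne (b i) y)|apply: (ne (a i) (c i))].
- by apply: (ne x y) => //; rewrite (sxb ord0) sby.
- move/place_inj; rewrite -!sxb => /(_ erefl)/iphi.
  by case.
Qed.

End Construction.

(** * Explicit bounds on [f] and passage to real exponents *)

Lemma has_free_rk_graph_pow3 (r m : nat) : 0 < m -> r <= 243 ^ m ->
  has_free_rk_graph r (theta 3 4) (2 * 27 ^ m).
Proof.
move=> m0 hr; have pow k : (3 ^ m) ^ k = (3 ^ k) ^ m by rewrite -!expnM mulnC.
have m2 : 0 < m * 2 by lia.
have [F pF cF] := pPrimePowerField (isT : prime 3) m2.
have cardF : #|F| = (3 ^ m) ^ 2 by rewrite cF expnM.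
have [eu [ew bij]] := splitting pF cardF m0.
pose T : finType := (F * ('I_(3 ^ m) * 'I_(3 ^ m) * 'I_(3 ^ m)))%type.
(* With [s = 3 ^ m] there are [s ^ 2 * s ^ 3 = 243 ^ m] codes; any [r] of them serve as classes. *)
have cT : r <= #|T|.
  rewrite !card_prod cardF !card_ord (leq_trans hr) // -[243]/(3 ^ 5) -pow.
  by rewrite !expnS !expn0 !muln1 !mulnA.
pose code (i : 'I_r) : T := enum_val (widen_ord cT i).
have code_inj : injective code.
  by move=> i j /enum_val_inj/(congr1 val) /= /val_inj.
split; first by rewrite muln_gt0 expn_gt0.
exists (cell_graph eu ew code); last exact (cell_graph_free (two_neq0 pF) bij code_inj).
by have := cell_graph_rk bij code; rewrite pow.
Qed.

Lemma f_theta34_bounds (r : nat) : 0 < r ->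
  [/\ 0 < f r (theta 3 4), r ^ 3 <= 1200 ^ 4 * f r (theta 3 4) ^ 5
    & f r (theta 3 4) ^ 5 <= 54 ^ 5 * r ^ 3].
Proof.
(* Now [243 ^ m <= r < 243 ^ m.+1]. The construction at [m.+1] gives the bound
   [2 * 27 ^ m.+1 = 54 * 27 ^ m], and [27 ^ (5 * m) = 243 ^ (3 * m)] is at most [r ^ 3]. *)
move=> r0; pose m := trunc_log 243 r.
have /andP[lo hi] := trunc_log_bounds (isT : 1 < 243) r0.
have [[k0 [G rkG frG]] kle] := f_minimum (has_free_rk_graph_pow3 (ltn0Sn m) (ltnW hi)).
set k := f r _ in k0 rkG kle *; split=> //.
  have [r1|] := leqP r 1; last by move=> r1; apply: rk_graph_leq r1 rkG frG.
  have -> : r = 1 by lia.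
  by rewrite exp1n muln_gt0 !expn_gt0 k0.
have : k <= 54 * 27 ^ m by move: kle; rewrite expnS; lia.
rewrite -(leq_exp2r _ _ (isT : 0 < 5)) => /leq_trans; apply.
rewrite expnMn leq_mul2l; apply/orP; right.
rewrite -[27]/(3 ^ 3) -!expnM (_ : 3 * (m * 5) = 5 * m * 3); last by lia.
by rewrite expnM leq_exp2r // expnM.
Qed.

Local Open Scope ring_scope.

Lemma powR_3_5 (R : realType) (r : nat) : (r%:R `^ (3 / 5)) ^+ 5 = (r ^ 3)%:R :> R.
Proof.
rewrite -powR_mulrn ?powR_ge0 // -powRrM natrX -powR_mulrn ?ler0n //.
by congr (_ `^ _); field.
Qed.

Theorem theorem1p7 (R : realType) :
  exists c C : R, [/\ 0 < c, 0 < C &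
    forall r : nat, (0 < r)%N ->
      c * (r%:R `^ (3 / 5)) < (f r (theta 3 4))%:R /\
      (f r (theta 3 4))%:R < C * (r%:R `^ (3 / 5))].
Proof.
(* Fifth roots give [t <= 1200 * k] and [k <= 54 * t]; the constants are relaxed to make both
   inequalities strict. *)
exists (1 / 2400), 55; split=> [||r r0]; [lra|lra|].
have [k0 low up] := f_theta34_bounds r0; set k := f r _ in k0 low up *.
have t5 := powR_3_5 R r; have tpos : 0 < r%:R `^ (3 / 5) :> R by rewrite powR_gt0 ?ltr0n.
move: t5 tpos; set t := _ `^ _ => t5 tpos; have t0 := ltW tpos.
have lowR (B : nat) : (0 < B)%N -> (r ^ 3 <= B ^ 4 * k ^ 5)%N -> t <= B%:R * k%:R.
  move=> B0 le; rewrite -(@ler_pXn2r _ 5) ?nnegrE ?mulr_ge0 ?ler0n //.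
  rewrite t5 exprMn -!natrX -natrM ler_nat (leq_trans le) // leq_mul2r [leqRHS]expnS.
  by rewrite leq_pmull // orbT.
have upR (B : nat) : (k ^ 5 <= B ^ 5 * r ^ 3)%N -> k%:R <= B%:R * t.
  move=> le; rewrite -(@ler_pXn2r _ 5) ?nnegrE ?mulr_ge0 ?ler0n //.
  by rewrite exprMn t5 -!natrX -natrM ler_nat.
have := lowR 1200 isT low; have := upR 54 up; clear low up lowR upR.
have kR : 0 < k%:R :> R by rewrite ltr0n.
by move=> h1 h2; split; lra.
Qed.
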